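(* Let $G$ be a simple graph on $n$ nodes which is neither complete nor null, with adjacency matrix $A$. Let $\mu_{\min}$ and $\mu_{\max}$ denote the minimum and the maximum eigenvalues of $V^TAV$, with multiplicities $m(\mu_{\min})$ and $m(\mu_{\max})$, respectively. Then: \begin{itemize} \item if $G$ is a cluster graph, then $\dim_E(G) = n-1-m(\mu_{\max})$; \item if $G$ is a complete multipartite graph, then $\dim_E(G) = n-1-m(\mu_{\min})$; \item otherwise, $\dim_E(G) = \min\{\, n-1-m(\mu_{\max}),\; n-1-m(\mu_{\min}) \,\}$. \end{itemize}
   Context: $e$ is the all-ones vector in $\mathbb{R}^n$. $V$ is an $n\times(n-1)$ matrix whose columns form an orthonormal basis of $e^\perp$, i.e. $V^Te=0$ and $V^TV=I_{n-1}$ (the eigenvalues of $V^TAV$ and their multiplicities do not depend on the choice of $V$). A Euclidean representation of $G$ in $\mathbb{R}^r$ is a configuration of points $p^1,\ldots,p^n\in\mathbb{R}^r$ for which there are two distinct positive scalars $\alpha\neq\beta$ such that for all $i\neq j$, $\|p^i-p^j\|^2=\alpha$ if $\{i,j\}$ is an edge of $G$, and $\|p^i-p^j\|^2=\beta$ otherwise. $\dim_E(G)$ is the smallest $r$ for which $G$ admits a Euclidean representation in $\mathbb{R}^r$. A cluster graph is a disjoint union of complete graphs (an isolated node $K_1$ counts as complete). A complete multipartite graph is the complement of a cluster graph. The null graph is the graph with no edges, $\overline{K_n}$. *)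

(* Defs.v *)
From mathcomp Require Import all_boot all_order all_algebra.
From mathcomp Require Import reals.

Set Implicit Arguments.
Unset Strict Implicit.
Unset Printing Implicit Defensive.

Import Order.TTheory GRing.Theory Num.Theory.
Local Open Scope ring_scope.

(* A graph on n nodes is given by its edge relation on 'I_n. *)
Definition simple_graph (n : nat) (e : rel 'I_n) : Prop :=
  symmetric e /\ irreflexive e.

Definition complete_graph (n : nat) (e : rel 'I_n) : Prop :=
  forall i j, i != j -> e i j.

Definition null_graph (n : nat) (e : rel 'I_n) : Prop :=
  forall i j, ~~ e i j.

Definition compl_graph (n : nat) (e : rel 'I_n) : rel 'I_n :=
  fun i j => (i != j) && ~~ e i j.

(* The blocks of P are the node sets of the disjoint complete graphs. *)
Definition cluster_graph (n : nat) (e : rel 'I_n) : Prop :=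
  exists2 P : {set {set 'I_n}}, partition P [set: 'I_n] &
    forall i j, e i j = (i != j) && [exists B in P, (i \in B) && (j \in B)].

Definition complete_multipartite (n : nat) (e : rel 'I_n) : Prop :=
  cluster_graph (compl_graph e).

Definition adjmx (R : realType) (n : nat) (e : rel 'I_n) : 'M[R]_n :=
  \matrix_(i, j) (e i j)%:R.

(* Squared Euclidean norm; the library norm `|x| on matrices is the sup norm. *)
Definition sqnorm (R : realType) (r : nat) (x : 'rV[R]_r) : R :=
  \sum_(k < r) x 0 k ^+ 2.

Definition euclidean_representation (R : realType) (n : nat) (e : rel 'I_n)
    (r : nat) (p : 'I_n -> 'rV[R]_r) : Prop :=
  exists alpha beta : R,
    [/\ 0 < alpha, 0 < beta, alpha != beta &
        forall i j, i != j ->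
          sqnorm (p i - p j) = if e i j then alpha else beta].

Definition representable (R : realType) (n : nat) (e : rel 'I_n) (r : nat) :
    Prop :=
  exists p : 'I_n -> 'rV[R]_r, euclidean_representation e p.

(* dim_E(G) = d, including that the minimum is attained. *)
Definition is_dimE (R : realType) (n : nat) (e : rel 'I_n) (d : nat) : Prop :=
  representable R e d /\ forall r : nat, representable R e r -> (d <= r)%N.

(* The columns of V form an orthonormal basis of the orthogonal complement of
   the all-ones vector. *)
Definition orthonormal_basis_ones_perp (R : realType) (n : nat)
    (V : 'M[R]_(n, n.-1)) : Prop :=
  V^T *m (const_mx 1 : 'cV[R]_n) = 0 /\ V^T *m V = 1%:M.

Definition is_min_eigenvalue (R : realType) (m : nat) (B : 'M[R]_m) (mu : R) :
    Prop :=
  eigenvalue B mu /\ forall nu : R, eigenvalue B nu -> mu <= nu.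

Definition is_max_eigenvalue (R : realType) (m : nat) (B : 'M[R]_m) (mu : R) :
    Prop :=
  eigenvalue B mu /\ forall nu : R, eigenvalue B nu -> nu <= mu.

(* Algebraic multiplicity; for the symmetric matrices considered here it is
   also the dimension of the eigenspace. *)
Definition eigen_mult (R : realType) (m : nat) (B : 'M[R]_m) (mu : R) : nat :=
  mup mu (char_poly B).

(* Main.v *)
Require Import Defs.
From mathcomp Require Import all_boot all_order all_algebra.
From mathcomp Require Import complex reals.
From mathcomp Require Import ring lra.

Set Implicit Arguments.
Unset Strict Implicit.
Unset Printing Implicit Defensive.

Import Order.TTheory GRing.Theory Num.Theory.
Local Open Scope ring_scope.

(** Write B = V^T A V.  Centring a configuration with squared distance matrix D
    by V turns D into -2 times a Gram matrix, and for a two-distance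
    configuration V^T D V = - (beta I + (beta - alpha) B).  Hence, by
    [representableP], G is representable in dimension r exactly when for some
    distinct positive alpha, beta the pencil M = beta I + (beta - alpha) B is
    positive semidefinite of rank at most r; one direction needs that a positive
    semidefinite matrix of rank at most r is the Gram matrix of vectors of
    length r, [psd_gram].

    The rank of M drops below n - 1 only if nu = beta / (alpha - beta) is an
    eigenvalue of B, and semidefiniteness then forces nu to be extremal.  If
    alpha > beta, then nu is positive and equal to mu_max; if alpha < beta, then
    nu is smaller than -1 and equal to mu_min.  The rank is n - 1 minus the
    multiplicity of nu, because for symmetric matrices algebraic and geometric
    multiplicity agree ([symmetric_rank_mup]).  So the multiplicity of mu_max can
    be gained iff mu_max > 0, and that of mu_min iff mu_min < -1
    ([representable_mu_max], [representable_mu_min],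
    [representable_lower_bound]).

    These two sign conditions are combinatorial.  If G is a cluster graph, then
    I + A is a Gram matrix and mu_min >= -1; otherwise G has an induced path
    i, j, k and the vector (1, -2, 1) on it is orthogonal to the all-ones vector
    and has Rayleigh quotient -8/6.  In the complement the same two arguments
    show that mu_max <= 0 iff G is complete multipartite.  A graph that is
    neither complete nor null is not both a cluster graph and complete
    multipartite, so the extreme eigenvalue named in each case is available. *)

(** * Spectral theory of real symmetric matrices *)

Lemma rank_diag_mx (F : fieldType) (m : nat) (d : 'rV[F]_m) :
  \rank (diag_mx d) = (\sum_(i < m) (d ord0 i != 0%R))%N.
Proof.
elim: m => [|m IHm] in d *.
  by apply/eqP; rewrite big_ord0 -leqn0 rank_leq_row.
rewrite big_ord_recl.
have -> : diag_mx d = diag_mx (row_mx (@lsubmx _ 1 1 m d) (@rsubmx _ 1 1 m d)).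
  by rewrite hsubmxK.
rewrite diag_mx_row [LHS](@rank_diag_block_mx _ 1 1 m m) IHm; congr (_ + _)%N.
  rewrite rank_rV; congr (nat_of_bool (~~ _)).
  apply/eqP/eqP => [/matrixP/(_ ord0 ord0)|d0].
    rewrite !mxE eqxx mulr1n => <-; congr (d _ _); exact: ord_inj.
  apply/matrixP=> i j; rewrite !mxE !ord1 eqxx mulr1n -[RHS]d0.
  by congr (d _ _); apply: ord_inj.
apply: eq_bigr => i _; rewrite mxE; congr (nat_of_bool (d _ _ != _)).
exact: ord_inj.
Qed.

Lemma char_poly_similar (K : fieldType) (m : nat) (P A B : 'M[K]_m) :
  P \in unitmx -> B = invmx P *m A *m P -> char_poly B = char_poly A.
Proof.
move=> uP ->; rewrite /char_poly.
have PK : map_mx polyC (invmx P) *m map_mx polyC P = 1%:M.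
  by rewrite -map_mxM mulVmx // map_mx1.
have -> : char_poly_mx (invmx P *m A *m P)
        = map_mx polyC (invmx P) *m char_poly_mx A *m map_mx polyC P.
  rewrite /char_poly_mx !map_mxM mulmxBr mulmxBl; congr (_ - _).
  by rewrite scalar_mxC -mulmxA PK mulmx1.
by rewrite !det_mulmx mulrAC -det_mulmx PK det1 mul1r.
Qed.

Section RealSymmetric.
Variables (R : realType) (m : nat).
Local Notation toC := (real_complex R).
Local Notation C := (complex R).
Local Open Scope sesquilinear_scope.

(** Over the complex numbers B is Hermitian, so it is unitarily diagonalizable
    with real eigenvalues; the eigenvectors may remain complex, since only
    ranks, characteristic polynomials and signs are read off. *)
Lemma symmetric_unitary_diag (B : 'M[R]_m) : B^T = B ->
  exists (d : 'rV[R]_m) (U : 'M[C]_m), U \is unitarymx /\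
    map_mx toC B = U^t* *m diag_mx (map_mx toC d) *m U.
Proof.
move=> symB; set Bc := map_mx toC B.
have toC_real x : toC x \is Num.real by apply/complex_realP; exists x.
have hermB : Bc \is hermsymmx.
  apply: realsym_hermsym.
    by apply/is_hermitianmxP; rewrite scale1r map_mx_id // map_trmx symB.
  by apply/mxOverP => i j; rewrite mxE.
have /orthomx_spectralP BE := hermitian_normalmx hermB.
have /mxOverP dreal := hermitian_spectral_diag_real hermB.
exists (map_mx (@complex.Re R) (spectral_diag Bc)), (spectralmx Bc).
split; first exact: spectral_unitarymx.
rewrite [LHS]BE invmx_unitary ?spectral_unitarymx //.
congr (_ *m diag_mx _ *m _); apply/matrixP=> i j; rewrite !mxE.
by have /complex_realP[x ->] := dreal i j.
Qed.

(** All roots of the characteristic polynomial are the real entries of d: the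
    identity holds over the complex numbers and coefficients embed injectively. *)
Lemma symmetric_char_poly (B : 'M[R]_m) (d : 'rV[R]_m) (U : 'M[C]_m) :
  U \is unitarymx -> map_mx toC B = U^t* *m diag_mx (map_mx toC d) *m U ->
  char_poly B = \prod_(i < m) ('X - (d 0 i)%:P).
Proof.
move=> unitU BE; apply: (@map_poly_inj _ _ toC).
rewrite map_char_poly /= (@char_poly_similar _ _ U (diag_mx (map_mx toC d))).
- rewrite char_poly_trig ?diag_mx_is_trig // rmorph_prod /=.
  apply: eq_bigr => i _.
  by rewrite !mxE eqxx mulr1n rmorphB /= map_polyX map_polyC.
- exact: unitarymx_unit.
- by rewrite invmx_unitary.
Qed.

(** Algebraic and geometric multiplicity agree: both count the entries of d
    equal to a. *)
Lemma symmetric_rank_mup (B : 'M[R]_m) (a : R) : B^T = B ->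
  \rank (B - a%:M) = (m - mup a (char_poly B))%N.
Proof.
move=> /symmetric_unitary_diag[d [U [unitU BE]]].
have uU := unitarymx_unit unitU.
have -> : \rank (B - a%:M) = \rank (diag_mx (d - const_mx a)).
  rewrite -(mxrank_map toC) -[RHS](mxrank_map toC) map_mxB BE map_scalar_mx.
  have -> : (toC a)%:M = U^t* *m (toC a)%:M *m U :> 'M_m.
    by rewrite scalar_mxC -mulmxA -invmx_unitary // mulVmx // mulmx1.
  rewrite -mulmxBl -mulmxBr mxrankMfree ?row_free_unit //.
  rewrite eqmxMfull ?row_full_unit -?invmx_unitary ?unitmx_inv //.
  by rewrite -diag_const_mx -linearB /= map_diag_mx map_mxB map_const_mx.
have mupE : mup a (char_poly B) = (\sum_(i < m) (d ord0 i == a))%N.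
  rewrite (symmetric_char_poly unitU BE) -(big_map (d 0) xpredT
    (fun y => 'X - y%:P)) mu_prod_XsubC count_map -sum1_count big_mkcond /=.
  by rewrite /index_enum -enumT big_enum; apply: eq_bigr => i _; case: eqP.
rewrite rank_diag_mx mupE; apply/esym/eqP.
rewrite -(eqn_add2r (\sum_(i < m) (d ord0 i == a))%N).
rewrite subnK.
  rewrite -big_split /= -[X in X == _](card_ord m) -sum1_card.
  apply/eqP/eq_bigr => i _.
  by rewrite !mxE subr_eq0; case: eqP.
rewrite -[X in (_ <= X)%N](card_ord m) -sum1_card.
by apply: leq_sum => i _; apply: leq_b1.
Qed.

(** In the unitary coordinates y of x, the form is the sum of d_i |y_i|^2. *)
Lemma symmetric_form_ge0 (B : 'M[R]_m) : B^T = B ->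
  (forall a, eigenvalue B a -> 0 <= a) ->
  forall x : 'rV_m, 0 <= (x *m B *m x^T) 0 0.
Proof.
move=> /symmetric_unitary_diag[d [U [unitU BE]]] eig_ge0 x.
have d_ge0 i : 0 <= d 0 i.
  apply: eig_ge0; rewrite eigenvalue_root_char (symmetric_char_poly unitU BE).
  by rewrite (bigD1 i) //= rootM root_XsubC eqxx.
pose y := map_mx toC x *m U^t*.
rewrite -lecR rmorph0.
have -> : toC ((x *m B *m x^T) 0 0) = (y *m diag_mx (map_mx toC d) *m y^t*) 0 0.
  transitivity (map_mx toC (x *m B *m x^T) 0 0); first by rewrite [RHS]mxE.
  rewrite !map_mxM BE /y trmx_mul map_mxM trmxCK !mulmxA; congr ((_ *m _) 0 0).
  apply/matrixP=> i j; rewrite !mxE; symmetry; exact: conjc_real.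
rewrite mul_mx_diag mxE sumr_ge0 // => i _.
by rewrite !mxE mulrAC mulr_ge0 ?mul_conjC_ge0 // lecR.
Qed.

End RealSymmetric.

(** * Positive semidefinite matrices and Gram matrices *)

Section PositiveSemidefinite.
Variables (R : realType) (m : nat).
Implicit Types (M : 'M[R]_m) (x y : 'rV[R]_m).

Definition bform M x y : R := (x *m M *m y^T) 0 0.

Definition psd M := M^T = M /\ forall x, 0 <= bform M x x.

Lemma bformC M x y : M^T = M -> bform M x y = bform M y x.
Proof.
move=> symM; rewrite /bform.
transitivity ((x *m M *m y^T)^T 0 0); first by rewrite [RHS]mxE.
by rewrite !trmx_mul trmxK symM mulmxA.
Qed.

Lemma bform_comb M x y (s t : R) : M^T = M ->
  bform M (s *: x + t *: y) (s *: x + t *: y)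
  = s ^+ 2 * bform M x x + 2 * s * t * bform M x y + t ^+ 2 * bform M y y.
Proof.
move=> symM; have := bformC y x symM; rewrite /bform => yx.
rewrite linearD /= !linearZ /= !(mulmxDl, mulmxDr) -!scalemxAl -!scalemxAr.
have addE (A B : 'M[R]_1) : (A + B) 0 0 = A 0 0 + B 0 0 by rewrite mxE.
have sclE c (A : 'M[R]_1) : (c *: A) 0 0 = c * A 0 0 by rewrite mxE.
rewrite !(addE, sclE) yx; ring.
Qed.

Lemma bform_delta M i j : bform M (delta_mx 0 i) (delta_mx 0 j) = M i j.
Proof. by rewrite /bform -rowE trmx_delta -colE !mxE. Qed.

Lemma psd_cauchy_schwarz M x y : psd M ->
  bform M x y ^+ 2 <= bform M x x * bform M y y.
Proof.
move=> [symM M_ge0].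
have a_ge0 := M_ge0 x; have c_ge0 := M_ge0 y.
have comb_ge0 s t : 0 <= s ^+ 2 * bform M x x + 2 * s * t * bform M x y
                         + t ^+ 2 * bform M y y by rewrite -bform_comb.
move: (bform M x x) (bform M x y) (bform M y y) a_ge0 c_ge0 comb_ge0.
move=> a b c a_ge0; rewrite le_eqVlt => /predU1P[<-|c_gt0] comb_ge0; last first.
  have := comb_ge0 c (- b).
  have -> : c ^+ 2 * a + 2 * c * - b * b + (- b) ^+ 2 * c = c * (a * c - b ^+ 2).
    by ring.
  by rewrite pmulr_rge0 // subr_ge0.
have [->|b_neq0] := eqVneq b 0; first by rewrite expr0n mulr0.
(* With c = 0 and b nonzero, t = - (a + 1) / (2 b) gives the value - 1. *)
have := comb_ge0 1 (- (a + 1) / (2 * b)).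
suff -> : 1 ^+ 2 * a + 2 * 1 * (- (a + 1) / (2 * b)) * b
          + (- (a + 1) / (2 * b)) ^+ 2 * 0 = - 1 by rewrite oppr_ge0 ler10.
by field; rewrite b_neq0.
Qed.

(** Subtract from M the rank-one matrix M u^T u M / (u M u^T), where u is a basis
    vector with u M u^T > 0.  The Cauchy-Schwarz inequality keeps the difference
    positive semidefinite, and u enters its kernel while the row space does not
    grow, so the rank drops and induction applies.  If there is no such u, then
    the diagonal of M vanishes, hence M = 0. *)
Lemma psd_gram k M : psd M -> (\rank M <= k)%N ->
  exists Y : 'M_(m, k), M = Y *m Y^T.
Proof.
elim: k M => [|k IHk] M psdM rankM.
  by exists 0; apply/eqP; rewrite mul0mx -mxrank_eq0 -leqn0.
have [symM M_ge0] := psdM.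
have [i Mii_neq0|diag0] := pickP (fun i => M i i != 0); last first.
  exists 0; rewrite mul0mx; apply/matrixP=> i j; rewrite mxE.
  have := psd_cauchy_schwarz (delta_mx 0 i) (delta_mx 0 j) psdM.
  have /negbFE/eqP diag0i := diag0 i.
  rewrite !bform_delta diag0i mul0r => Mij_le0.
  by apply/eqP; rewrite -sqrf_eq0 eq_le Mij_le0 sqr_ge0.
have Mii_gt0 : 0 < M i i by rewrite lt_def Mii_neq0 -bform_delta M_ge0.
pose u : 'rV[R]_m := delta_mx 0 i.
pose c := (Num.sqrt (M i i))^-1.
have c2 : c * c = (M i i)^-1.
  by rewrite -invfM -expr2 sqr_sqrtr // ltW.
pose y := c *: (M *m u^T).
pose M' := M - y *m y^T.
have formM' x : bform M' x x = bform M x x - bform M x u ^+ 2 / M i i.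
  rewrite /bform /M' mulmxBr mulmxBl mxE [X in _ + X]mxE; congr (_ - _).
  rewrite mulmxA -mulmxA -trmx_mul mxE big_ord1 [X in _ * X]mxE.
  by rewrite -[in LHS]expr2 /y -scalemxAr mulmxA mxE exprMn [c ^+ 2]expr2 c2 mulrC.
have psdM' : psd M'.
  split=> [|x]; first by rewrite /M' linearB /= trmx_mul trmxK symM.
  rewrite formM' subr_ge0 ler_pdivrMr // -[M i i]bform_delta.
  exact: psd_cauchy_schwarz.
have yE : y *m y^T = (M i i)^-1 *: (M *m u^T *m (u *m M)).
  by rewrite /y linearZ /= trmx_mul trmxK symM -scalemxAl -scalemxAr scalerA c2.
have uM'0 : M' *m u^T = 0.
  rewrite /M' yE mulmxBl -scalemxAl -!mulmxA.
  have -> : u *m (M *m u^T) = (M i i)%:M.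
    apply/matrixP=> a b; rewrite !ord1 mulmxA [RHS]mxE eqxx mulr1n.
    exact: bform_delta.
  by rewrite mul_mx_scalar -scalemxAr scalerA mulVf // scale1r subrr.
have ltM' : (M' < M)%MS.
  rewrite /ltmx {1}/M' yE; apply/andP; split.
    by rewrite addmx_sub // eqmx_opp scalemx_sub // mulmxA submxMl.
  apply/negP => /submxP[Z MZ].
  have /eqP[] := Mii_neq0; rewrite -bform_delta /bform -mulmxA -/u MZ.
  by rewrite -[Z *m _ *m _]mulmxA uM'0 !mulmx0 mxE.
have [Y M'Y] := IHk _ psdM' (leq_trans (rank_ltmx ltM') rankM).
exists (row_mx y Y); rewrite (tr_row_mx y Y) (mul_row_col y Y).
by rewrite -M'Y addrC subrK.
Qed.
End PositiveSemidefinite.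

(** * Pencils s I + t B and their eigenvalues *)

Section Eigenvalues.
Variables (R : realType) (m : nat).
Implicit Types (B M : 'M[R]_m) (x : 'rV[R]_m).

Lemma bform_gram_ge0 k (Y : 'M[R]_(m, k)) x : 0 <= bform (Y *m Y^T) x x.
Proof.
rewrite /bform mulmxA -mulmxA -trmx_mul mxE sumr_ge0 // => i _.
by rewrite [X in _ * X]mxE -expr2 sqr_ge0.
Qed.

Lemma bform1_gt0 x : x != 0 -> 0 < bform 1%:M x x.
Proof.
move=> x_neq0; rewrite /bform mulmx1 mxE lt_def sumr_ge0 ?andbT => [|i _].
  apply: contra x_neq0 => /eqP x2_eq0; apply/eqP/rowP => i.
  have /(_ i isT)/eqP : forall i, true -> x 0 i * x^T i 0 = 0.
    apply/psumr_eq0P => // j _; by rewrite mxE -expr2 sqr_ge0.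
  by rewrite !mxE mulf_eq0 orbb => /eqP.
by rewrite mxE -expr2 sqr_ge0.
Qed.

Lemma bform_scalarD B (s t : R) x :
  bform (s%:M + t *: B) x x = s * bform 1%:M x x + t * bform B x x.
Proof.
rewrite /bform -[s%:M]scalemx1 mulmxDr mulmxDl -!scalemxAr -!scalemxAl.
by rewrite !mxE.
Qed.

Lemma bform_eigenvector B (a : R) x :
  x *m B = a *: x -> bform B x x = a * bform 1%:M x x.
Proof. by rewrite /bform mulmx1 => ->; rewrite -scalemxAl mxE. Qed.

Lemma eigenvalue_pencil_ge0 B (s t a : R) :
  psd (s%:M + t *: B) -> eigenvalue B a -> 0 <= s + t * a.
Proof.
move=> [_ /[swap] /eigenvalueP[x Bx x_neq0] /(_ x)].
rewrite bform_scalarD (bform_eigenvector Bx) mulrA -mulrDl pmulr_lge0 //.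
exact: bform1_gt0.
Qed.

(** The eigenvalues of s I + t B are the numbers s + t a with a an eigenvalue
    of B. *)
Lemma pencil_psd B (s t : R) : B^T = B -> t != 0 ->
  (forall a, eigenvalue B a -> 0 <= s + t * a) -> psd (s%:M + t *: B).
Proof.
move=> symB t_neq0 ge0.
have symM : (s%:M + t *: B)^T = s%:M + t *: B.
  by rewrite linearD linearZ /= tr_scalar_mx symB.
split=> //; apply: symmetric_form_ge0 => // a /eigenvalueP[x].
rewrite mulmxDr mul_mx_scalar -scalemxAr => xE x_neq0.
have txB : t *: (x *m B) = (a - s) *: x by rewrite scalerBl -xE addrC addKr.
have aE : a = s + t * (t^-1 * (a - s)) by rewrite mulVKf // addrC subrK.
rewrite aE; apply: ge0; apply/eigenvalueP; exists x => //.
by rewrite -scalerA -txB scalerA mulVf // scale1r.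
Qed.

Lemma pencil_rank B (s t a : R) : B^T = B -> t != 0 -> s + t * a = 0 ->
  \rank (s%:M + t *: B)%R = (m - mup a (char_poly B))%N.
Proof.
move=> symB t_neq0 sta; rewrite -symmetric_rank_mup //.
rewrite -(mxrank_scale_nz (B - a%:M) t_neq0); congr (\rank _).
move/eqP: sta; rewrite addr_eq0 => /eqP ->.
apply/matrixP=> i j; rewrite !mxE.
by case: eqP => _ /=; rewrite ?mulr1n ?mulr0n; ring.
Qed.

Lemma pencil_full_rank B (s t a : R) : B^T = B -> t != 0 -> s + t * a = 0 ->
  ~~ eigenvalue B a -> \rank (s%:M + t *: B)%R = m.
Proof.
move=> symB t_neq0 sta; rewrite eigenvalue_root_char => not_root.
by rewrite (pencil_rank symB t_neq0 sta) mupNroot // subn0.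
Qed.
End Eigenvalues.

(** * Cluster graphs and induced paths on three nodes *)

Section Graphs.
Variable n : nat.
Implicit Types (e : rel 'I_n) (i j k : 'I_n).

Lemma compl_graph_simple e : simple_graph e -> simple_graph (compl_graph e).
Proof.
move=> [sym_e irr_e]; split=> [i j|i]; rewrite /compl_graph.
  by rewrite eq_sym sym_e.
by rewrite eqxx.
Qed.

Lemma cluster_graph_blocks e : cluster_graph e ->
  exists f : 'I_n -> {set 'I_n}, forall i j, e i j = (i != j) && (f i == f j).
Proof.
move=> [P /and3P[/eqP coverP trivP _] eE]; exists (pblock P) => i j.
have inP k : k \in cover P by rewrite coverP inE.
rewrite eE; congr (_ && _); apply/existsP/eqP => [[B /and3P[PB Bi Bj]]|ij].
  by rewrite (def_pblock trivP PB Bi) (def_pblock trivP PB Bj).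
by exists (pblock P i); rewrite pblock_mem // mem_pblock inP ij mem_pblock inP.
Qed.

Lemma cluster_graph_trans e i j k :
  cluster_graph e -> e i j -> e j k -> i != k -> e i k.
Proof.
case/cluster_graph_blocks => f eE; rewrite !eE => /andP[_ /eqP->] /andP[_ ->] ->.
by [].
Qed.

(** Without an induced path on three nodes, being equal or adjacent is an
    equivalence relation, and its classes are the required blocks. *)
Lemma induced_path_of_not_cluster e : simple_graph e -> ~ cluster_graph e ->
  exists i j k, [/\ e i j, e j k, i != k & ~~ e i k].
Proof.
move=> [sym_e irr_e] not_cluster.
have [/'exists_'exists_'exists_and4P[i [j [k path_ijk]]]|no_path] := boolP
    [exists i, exists j, exists k, [&& e i j, e j k, i != k & ~~ e i k]].
  by exists i, j, k.
case: not_cluster; pose r : rel 'I_n := fun i j => (i == j) || e i j.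
have trans_e i j k : e i j -> e j k -> r i k.
  move=> eij ejk; apply: contraNT no_path; rewrite negb_or => /andP[ik eik].
  apply/'exists_'exists_'exists_and4P; exists i, j, k; by split.
have rr i : r i i by rewrite /r eqxx.
have equiv_r : {in [set: 'I_n] & &, equivalence_rel r}.
  move=> i j k _ _ _; split=> // /predU1P[->//|eij].
  apply/idP/idP => /predU1P[<-|ejk]; rewrite /r.
  - by rewrite sym_e eij orbT.
  - by apply: trans_e ejk; rewrite sym_e.
  - by rewrite eij orbT.
  - exact: trans_e ejk.
exists (equivalence_partition r [set: 'I_n]).
  exact: equivalence_partitionP.
have /and3P[/eqP coverP trivP _] := equivalence_partitionP equiv_r.
move=> i j.
have -> : [exists B in equivalence_partition r [set: 'I_n],
             (i \in B) && (j \in B)] = r i j.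
  rewrite -(pblock_equivalence_partition equiv_r) ?inE //.
  apply/existsP/idP => [[B /and3P[PB Bi Bj]]|ij].
    by rewrite (def_pblock trivP PB Bi).
  exists (pblock (equivalence_partition r [set: 'I_n]) i).
  by rewrite pblock_mem ?mem_pblock ?coverP ?inE.
by rewrite /r; case: eqVneq => [->|]; rewrite ?irr_e.
Qed.

(** Fix an edge ab.  A node x distinct from and not adjacent to a would contradict
    transitivity of adjacency along x, b, a when x is adjacent to b, and
    transitivity of non-adjacency along a, x, b when it is not.  So every node is
    adjacent to a, and then by transitivity through a the graph is complete. *)
Lemma cluster_multipartite_excl e : simple_graph e ->
  ~ complete_graph e -> ~ null_graph e ->
  cluster_graph e -> complete_multipartite e -> False.
Proof.
move=> [sym_e irr_e] not_complete not_null cl_e cl_ce.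
apply: not_null => a b; apply/negP => eab; apply: not_complete => c d cd.
have adj_a x : x != a -> e x a.
  move=> xa; apply: contraT => not_exa.
  have [exb|not_exb] := boolP (e x b).
    case/negP: not_exa; apply: (cluster_graph_trans cl_e exb _ xa).
    by rewrite sym_e.
  have xb : x != b by apply: contraNneq not_exa => ->; rewrite sym_e.
  have ab : a != b by apply: contraTneq eab => ->; rewrite irr_e.
  have := @cluster_graph_trans _ a x b cl_ce.
  rewrite /compl_graph eq_sym xa sym_e not_exa xb not_exb ab eab.
  by move=> /(_ isT isT isT).
have [ca|ca] := eqVneq c a.
  by rewrite ca sym_e adj_a // -ca eq_sym.
have [->|da] := eqVneq d a; first exact: adj_a.
by apply: (cluster_graph_trans cl_e (adj_a c ca) _ cd); rewrite sym_e adj_a.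
Qed.

End Graphs.

(** * Representations as positive semidefinite pencils *)

Section Representation.
Variables (R : realType) (n : nat) (e : rel 'I_n) (V : 'M[R]_(n, n.-1)).
Hypotheses (G_simple : simple_graph e) (V_basis : orthonormal_basis_ones_perp V).
Local Notation A := (adjmx R e).
Local Notation B := (V^T *m A *m V).
Local Notation ones := (const_mx 1 : 'cV[R]_n).
Local Notation delta i := (delta_mx 0 i : 'rV[R]_n).

Lemma adjmx_sym : A^T = A.
Proof. by apply/matrixP=> i j; rewrite !mxE G_simple.1. Qed.

Lemma compressed_sym : B^T = B.
Proof. by rewrite !trmx_mul trmxK adjmx_sym mulmxA. Qed.

Lemma ones_trV : ones^T *m V = 0.
Proof. by rewrite -[V]trmxK -trmx_mul V_basis.1 trmx0. Qed.

(** The columns of V are n - 1 independent vectors in the (n - 1)-dimensional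
    orthogonal complement of the all-ones vector, so they span it. *)
Lemma trV_kermx_ones : (V^T :=: kermx ones)%MS.
Proof.
have [Vones VV] := V_basis.
apply/eqmxP; rewrite -(geq_leqif (mxrank_leqif_eq _)); last exact/sub_kermxP.
have -> : \rank V^T = n.-1.
  apply/eqP; rewrite mxrank_tr eqn_leq rank_leq_col -{1}(mxrank1 R n.-1) -VV.
  exact: mxrankM_maxr.
rewrite mxrank_ker; case: (n) => // n'.
have -> : \rank (const_mx 1 : 'cV[R]_n'.+1) = 1%N.
  apply/eqP; rewrite eqn_leq rank_leq_col lt0n mxrank_eq0.
  by apply/eqP=> /matrixP/(_ ord0 ord0)/eqP; rewrite !mxE oner_eq0.
by rewrite subn1.
Qed.

(** V V^T is the orthogonal projection onto the complement of the all-ones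
    vector. *)
Lemma proj_ones_perp (w : 'rV[R]_n) : w *m ones = 0 -> w *m V *m V^T = w.
Proof.
move/sub_kermxP; rewrite -trV_kermx_ones => /submxP[z ->].
by rewrite -[z *m V^T *m V]mulmxA V_basis.2 mulmx1.
Qed.

Lemma bform_compress (S : 'M[R]_n) (w : 'rV[R]_n) : w *m ones = 0 ->
  bform (V^T *m S *m V) (w *m V) (w *m V) = bform S w w.
Proof.
move=> w_perp; have wE := proj_ones_perp w_perp.
have := congr1 trmx wE; rewrite !trmx_mul trmxK => wtE.
by rewrite /bform trmx_mul !mulmxA wE -!mulmxA wtE.
Qed.

Lemma bform_lift (S : 'M[R]_n) (x : 'rV[R]_n.-1) :
  bform S (x *m V^T) (x *m V^T) = bform (V^T *m S *m V) x x.
Proof. by rewrite /bform trmx_mul trmxK !mulmxA. Qed.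

Lemma lift_perp (x : 'rV[R]_n.-1) : x *m V^T *m ones = 0.
Proof. by rewrite -mulmxA V_basis.1 mulmx0. Qed.

Definition dist_mx (alpha beta : R) : 'M[R]_n :=
  \matrix_(i, j) if i == j then 0 else if e i j then alpha else beta.

(** D = beta J - (beta I + (beta - alpha) A) with J the all-ones matrix, which V
    annihilates. *)
Lemma compress_dist_mx (alpha beta : R) :
  V^T *m dist_mx alpha beta *m V
  = - (beta%:M + (beta - alpha) *: B).
Proof.
have -> : dist_mx alpha beta
        = beta *: (ones *m ones^T) - (beta%:M + (beta - alpha) *: A).
  apply/matrixP=> i j; rewrite !mxE big_ord1 !mxE.
  case: eqVneq => [->|_] /=; last case: (e i j); rewrite ?G_simple.2 /=;
    rewrite ?mulr1n ?mulr0n; ring.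
rewrite mulmxBr mulmxBl -scalemxAr mulmxA V_basis.1 mul0mx scaler0 mul0mx sub0r.
congr (- _); rewrite mulmxDr mulmxDl -scalemxAr -scalemxAl; congr (_ + _).
by rewrite mul_mx_scalar -scalemxAl V_basis.2 scalemx1.
Qed.

Lemma sqnormE r (x : 'rV[R]_r) : sqnorm x = (x *m x^T) 0 0.
Proof. by rewrite mxE; apply: eq_bigr => i _; rewrite mxE expr2. Qed.

(** The polarization |p_i - p_j|^2 = |p_i|^2 + |p_j|^2 - 2 p_i.p_j shows that
    -V^T D V is twice the Gram matrix of the rows of V^T P.  Conversely, a Gram
    factorization M = Y Y^T gives the points V Y / sqrt 2: the difference of two
    standard basis vectors is orthogonal to the all-ones vector, so V V^T fixes
    it and the distances are recovered from M. *)
Lemma representableP r : representable R e r <->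
  exists alpha beta : R, [/\ 0 < alpha, 0 < beta, alpha != beta,
    psd (beta%:M + (beta - alpha) *: B) &
    (\rank (beta%:M + (beta - alpha) *: B)%R <= r)%N].
Proof.
split=> [[p [alpha [beta [alpha_gt0 beta_gt0 ab pE]]]]|].
  exists alpha, beta.
  pose P := \matrix_(i < n, k < r) p i 0 k.
  pose g := \col_(i < n) sqnorm (p i).
  have DE : dist_mx alpha beta
      = g *m ones^T + ones *m g^T - 2 *: (P *m P^T).
    apply/matrixP=> i j.
    have PP : (P *m P^T) i j = \sum_k p i 0 k * p j 0 k.
      by rewrite mxE; apply: eq_bigr => k _; rewrite !mxE.
    rewrite [RHS]mxE [X in X + _]mxE [X in _ + X]mxE [X in - X]mxE PP.
    rewrite ![(_ *m _ : 'M_n) i j]mxE !big_ord1 !mxE mulr1 mul1r.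
    have -> : (if i == j then 0 else if e i j then alpha else beta)
              = sqnorm (p i - p j).
      case: eqVneq => [->|/pE->//].
      by rewrite subrr /sqnorm big1 // => k _; rewrite mxE expr0n.
    rewrite /sqnorm mulr_sumr -big_split /= -sumrB; apply: eq_bigr => k _.
    by rewrite !mxE; ring.
  have ME : beta%:M + (beta - alpha) *: B = 2 *: (V^T *m P *m (V^T *m P)^T).
    rewrite -[LHS]opprK -compress_dist_mx DE mulmxBr mulmxBl mulmxDr mulmxDl.
    rewrite mulmxA -[_ *m V]mulmxA ones_trV mulmx0 mulmxA V_basis.1 !mul0mx.
    rewrite addr0 sub0r opprK -scalemxAr -scalemxAl; congr (_ *: _).
    by rewrite trmx_mul trmxK !mulmxA.
  rewrite ME; split=> //; last first.
    rewrite mxrank_scale_nz ?pnatr_eq0 //.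
    exact: leq_trans (mxrankM_maxr _ _) (rank_leq_row _).
  split; first by rewrite linearZ /= trmx_mul trmxK.
  move=> x; rewrite /bform -scalemxAr -scalemxAl mxE mulr_ge0 //.
  exact: bform_gram_ge0.
move=> [alpha [beta [alpha_gt0 beta_gt0 ab psdM rankM]]].
have [Y ME] := psd_gram psdM rankM.
(* M is twice the desired Gram matrix, hence the scaling of the points. *)
pose c : R := Num.sqrt 2^-1.
have c2 : c * c = 2^-1 by rewrite -expr2 sqr_sqrtr // invr_ge0.
exists (fun i => c *: (row i V *m Y)), alpha, beta; split=> // i j ij.
pose w := 1 *: delta i + (-1) *: delta j.
have w_perp : w *m ones = 0.
  rewrite mulmxDl -!scalemxAl -!rowE.
  by apply/matrixP=> a b; rewrite !mxE; ring.
have -> : c *: (row i V *m Y) - c *: (row j V *m Y) = c *: (w *m V *m Y).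
  by rewrite /w !mulmxDl -!scalemxAl -!rowE scalerDr scale1r scaleN1r scalerN.
rewrite sqnormE linearZ /= -scalemxAr -scalemxAl scalerA c2 mxE.
have -> : (w *m V *m Y *m (w *m V *m Y)^T) 0 0
        = - bform (dist_mx alpha beta) w w.
  rewrite -bform_compress // compress_dist_mx ME /bform mulmxN mulNmx [in RHS]mxE.
  by rewrite opprK [(_ *m Y)^T]trmx_mul !mulmxA.
rewrite bform_comb; last first.
  by apply/matrixP=> a b; rewrite !mxE eq_sym G_simple.1.
by rewrite !bform_delta !mxE !eqxx (negPf ij); field.
Qed.

End Representation.

(** * Extreme eigenvalues and the combinatorics of the graph *)

(** The factor N is the incidence matrix of nodes against blocks, so that
    (N N^T) i j is 1 when i and j share a block and 0 otherwise. *)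
Lemma cluster_graph_gram (R : realType) (n : nat) (e : rel 'I_n) :
  cluster_graph e ->
  exists (k : nat) (N : 'M[R]_(n, k)), 1%:M + adjmx R e = N *m N^T.
Proof.
case/cluster_graph_blocks => f eE; exists #|{set 'I_n}|.
exists (\matrix_(i, k) (f i == enum_val k)%:R).
apply/matrixP=> i j; rewrite !mxE (bigD1 (enum_rank (f i))) //= big1 => [|k ki].
  rewrite !mxE enum_rankK eqxx mul1r addr0 eE [f j == _]eq_sym.
  by case: eqVneq => [->|_]; rewrite ?eqxx ?addr0 // add0r.
rewrite !mxE [f i == _]eq_sym; case: eqP => [fi|_]; last by rewrite mul0r.
by rewrite -fi enum_valK eqxx in ki.
Qed.

Section Spectrum.
Variables (R : realType) (n : nat) (e : rel 'I_n) (V : 'M[R]_(n, n.-1)).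
Variables (mu_min mu_max : R).
Hypotheses (G_simple : simple_graph e) (V_basis : orthonormal_basis_ones_perp V).
Local Notation A := (adjmx R e).
Local Notation B := (V^T *m A *m V).
Hypotheses (mu_minP : is_min_eigenvalue B mu_min).
Hypotheses (mu_maxP : is_max_eigenvalue B mu_max).
Local Notation delta i := (delta_mx 0 i : 'rV[R]_n).

Let symB : B^T = B := compressed_sym V G_simple.

(** The scaling alpha - beta = 1 makes the pencil mu_max I - B; its constant
    beta = mu_max must be positive. *)
Lemma representable_mu_max : 0 < mu_max ->
  representable R e (n.-1 - eigen_mult B mu_max).
Proof.
move=> mu_gt0; apply/(representableP G_simple V_basis).
exists (mu_max + 1), mu_max.
have tE : mu_max - (mu_max + 1) = - 1 by ring.
rewrite tE; split=> //.
- by rewrite addr_gt0.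
- by rewrite -subr_eq0 addrC addKr oner_eq0.
- apply: pencil_psd; rewrite ?oppr_eq0 ?oner_eq0 // => a /mu_maxP.2 le_mu.
  by rewrite mulN1r subr_ge0.
rewrite (@pencil_rank _ _ _ _ _ mu_max) ?oppr_eq0 ?oner_eq0 //.
by rewrite mulN1r subrr.
Qed.

(** The scaling beta - alpha = 1 makes the pencil B - mu_min I; it is
    alpha = - mu_min - 1 that must be positive. *)
Lemma representable_mu_min : mu_min < -1 ->
  representable R e (n.-1 - eigen_mult B mu_min).
Proof.
move=> mu_lt; apply/(representableP G_simple V_basis).
exists (- mu_min - 1), (- mu_min).
have tE : - mu_min - (- mu_min - 1) = 1 by ring.
rewrite tE; split=> //.
- by lra.
- by lra.
- by rewrite -subr_eq0 addrC addKr oppr_eq0 oner_eq0.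
- apply: pencil_psd; rewrite ?oner_eq0 // => a /mu_minP.2 le_mu.
  by rewrite mul1r addrC subr_ge0.
rewrite (@pencil_rank _ _ _ _ _ mu_min) ?oner_eq0 //.
by rewrite mul1r addNr.
Qed.

(** The pencil is singular only if nu = beta / (alpha - beta) is an eigenvalue.
    Semidefiniteness, tested on an eigenvector of mu_max when alpha > beta and of
    mu_min when alpha < beta, bounds that extreme eigenvalue by nu, so the two
    are equal; the range of nu gives the sign condition. *)
Lemma representable_lower_bound r : representable R e r ->
  [\/ 0 < mu_max /\ (n.-1 - eigen_mult B mu_max <= r)%N,
      mu_min < -1 /\ (n.-1 - eigen_mult B mu_min <= r)%N |
      (n.-1 <= r)%N].
Proof.
move=> /(representableP G_simple V_basis)[a [b [a_gt0 b_gt0 ab psdM rankM]]].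
have t_neq0 : b - a != 0 by rewrite subr_eq0 eq_sym.
pose nu := b / (a - b).
have nuE : b + (b - a) * nu = 0.
  by rewrite /nu; field; rewrite subr_eq0.
have [eig_nu|not_eig] := boolP (eigenvalue B nu); last first.
  by constructor 3; rewrite -(pencil_full_rank symB t_neq0 nuE not_eig).
rewrite (pencil_rank symB t_neq0 nuE) in rankM.
have [lt_ab|le_ab] := ltrP b a.
  have nu_gt0 : 0 < nu by rewrite divr_gt0 // subr_gt0.
  have nu_max : mu_max = nu.
    apply/eqP; rewrite eq_le (mu_maxP.2 _ eig_nu) andbT.
    have := eigenvalue_pencil_ge0 psdM mu_maxP.1.
    by rewrite ler_pdivlMr ?subr_gt0 //; lra.
  by constructor 1; rewrite nu_max.
have lt_ab : a < b by rewrite lt_def eq_sym ab.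
have nu_lt : nu < -1.
  by rewrite ltr_ndivrMr ?subr_lt0 //; lra.
have nu_min : mu_min = nu.
  apply/eqP; rewrite eq_le (mu_minP.2 _ eig_nu) /=.
  have := eigenvalue_pencil_ge0 psdM mu_minP.1.
  by rewrite ler_ndivrMr ?subr_lt0 //; lra.
by constructor 2; rewrite nu_min.
Qed.

Lemma rayleigh_bounds (x : 'rV[R]_n.-1) :
  mu_min * bform 1%:M x x <= bform B x x <= mu_max * bform 1%:M x x.
Proof.
have min_psd : psd ((- mu_min)%:M + 1 *: B).
  apply: pencil_psd; rewrite ?oner_eq0 // => a /mu_minP.2 le_mu.
  by rewrite mul1r addrC subr_ge0.
have max_psd : psd (mu_max%:M + (- 1) *: B).
  apply: pencil_psd; rewrite ?oppr_eq0 ?oner_eq0 // => a /mu_maxP.2 le_mu.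
  by rewrite mulN1r subr_ge0.
have := min_psd.2 x; have := max_psd.2 x; rewrite !bform_scalarD; lra.
Qed.

(** An eigenvector y of B is lifted to y V^T, which keeps its norm and is
    orthogonal to the all-ones vector. *)
Lemma bform_eigenvalue mu : eigenvalue B mu ->
  exists x : 'rV[R]_n, [/\ x *m (const_mx 1 : 'cV_n) = 0,
    0 < bform 1%:M x x & bform A x x = mu * bform 1%:M x x].
Proof.
move=> /eigenvalueP[y yB y_neq0]; exists (y *m V^T).
rewrite !bform_lift mulmx1 V_basis.2 (bform_eigenvector yB); split=> //.
  exact: lift_perp.
exact: bform1_gt0.
Qed.

(** I + A is a Gram matrix, and its form at a lifted eigenvector is
    (mu_min + 1) |x|^2. *)
Lemma cluster_mu_min : cluster_graph e -> -1 <= mu_min.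
Proof.
move=> /(@cluster_graph_gram R)[k [N NE]].
have [x [_ x_gt0 xA]] := bform_eigenvalue mu_minP.1.
have := bform_gram_ge0 N x; rewrite -NE -[A]scale1r bform_scalarD xA !mul1r.
by rewrite -{1}[bform _ _ _]mul1r -mulrDl pmulr_lge0 // -lerBlDl sub0r.
Qed.

(** For the complement, I plus its adjacency matrix is J - A with J the all-ones
    matrix, and J vanishes on lifted eigenvectors. *)
Lemma multipartite_mu_max : complete_multipartite e -> mu_max <= 0.
Proof.
move=> /(@cluster_graph_gram R)[k [N NE]].
have [x [x_perp x_gt0 xA]] := bform_eigenvalue mu_maxP.1.
have AE : A = const_mx 1 *m (const_mx 1 : 'cV_n)^T - N *m N^T.
  rewrite -NE; apply/matrixP=> i j; rewrite !mxE big_ord1 !mxE /compl_graph.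
  case: eqVneq => [->|_] /=; first by rewrite G_simple.2 /= mulr1n mulr0n; ring.
  by case: (e i j); rewrite /= ?mulr1n ?mulr0n; ring.
have : bform A x x = - bform (N *m N^T) x x.
  by rewrite AE /bform mulmxBr mulmxBl mulmxA x_perp !mul0mx sub0r mxE.
rewrite xA => muE; rewrite -(pmulr_lle0 _ x_gt0) muE oppr_le0.
exact: bform_gram_ge0.
Qed.

Lemma induced_path_form (S : 'M[R]_n) i j k : S^T = S ->
  let w := 1 *: (1 *: delta i + 1 *: delta k) + (-2) *: delta j in
  bform S w w = S i i + S k k + 4 * S j j + 2 * S i k - 4 * S i j - 4 * S k j.
Proof.
move=> symS w; rewrite bform_comb // bform_comb //.
have -> : bform S (1 *: delta i + 1 *: delta k) (delta j) = S i j + S k j.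
  by rewrite -!(bform_delta S) /bform !scale1r !mulmxDl mxE.
rewrite !bform_delta; ring.
Qed.

(** Rayleigh bounds for the vector (1, -2, 1) supported on i, j, k, whose squared
    norm is 6. *)
Lemma induced_path_mu i j k : i != j -> j != k -> i != k ->
  mu_min * 6 <= 2 * A i k - 4 * A i j - 4 * A k j <= mu_max * 6.
Proof.
move=> ij jk ik.
pose w := 1 *: (1 *: delta i + 1 *: delta k) + (-2) *: delta j.
have w_perp : w *m (const_mx 1 : 'cV_n) = 0.
  rewrite !mulmxDl -!scalemxAl mulmxDl -!scalemxAl -!rowE.
  by apply/matrixP=> a b; rewrite !mxE; ring.
have := rayleigh_bounds (w *m V).
rewrite bform_compress //.
have -> : bform 1%:M (w *m V) (w *m V) = 6.
  rewrite -V_basis.2 -[V^T]mulmx1 bform_compress //.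
  rewrite induced_path_form ?trmx1 // !mxE !eqxx (negPf ij) (negPf ik).
  by rewrite eq_sym (negPf jk) /= ?mulr0n ?mulr1n; ring.
rewrite induced_path_form ?adjmx_sym // => H.
have diag0 l : A l l = 0 by rewrite mxE G_simple.2.
by move: H; rewrite !diag0 mulr0 !add0r.
Qed.

(** On an induced path the form takes the value -8, so mu_min <= -8/6. *)
Lemma not_cluster_mu_min : ~ cluster_graph e -> mu_min < -1.
Proof.
move=> /(induced_path_of_not_cluster G_simple)[i [j [k [eij ejk ik not_eik]]]].
have neq a b : e a b -> a != b by apply: contraTneq => ->; rewrite G_simple.2.
have /andP[+ _] := induced_path_mu (neq _ _ eij) (neq _ _ ejk) ik.
rewrite !mxE (negPf not_eik) eij [e k j]G_simple.1 ejk /=; lra.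
Qed.

(** On an induced path of the complement only i and k are adjacent in G, and the
    form takes the value 2, so mu_max >= 2/6. *)
Lemma not_multipartite_mu_max : ~ complete_multipartite e -> 0 < mu_max.
Proof.
move=> /(induced_path_of_not_cluster (compl_graph_simple G_simple)).
case=> i [j [k [/andP[ij not_eij] /andP[jk not_ejk] ik]]].
rewrite /compl_graph ik negbK /= => eik.
have /andP[_] := induced_path_mu ij jk ik.
rewrite !mxE eik (negPf not_eij) [e k j]G_simple.1 (negPf not_ejk) /=; lra.
Qed.

End Spectrum.

(** * The Euclidean dimension *)

Theorem mainTheorem1 (R : realType) (n : nat) (e : rel 'I_n)
    (V : 'M[R]_(n, n.-1)) (mu_min mu_max : R)
    (G_simple : simple_graph e)
    (G_not_complete : ~ complete_graph e)
    (G_not_null : ~ null_graph e)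
    (V_basis : orthonormal_basis_ones_perp V)
    (mu_minP : is_min_eigenvalue (V^T *m adjmx R e *m V) mu_min)
    (mu_maxP : is_max_eigenvalue (V^T *m adjmx R e *m V) mu_max) :
  let m := eigen_mult (V^T *m adjmx R e *m V) in
  [/\ cluster_graph e -> is_dimE R e (n - 1 - m mu_max)%N,
      complete_multipartite e -> is_dimE R e (n - 1 - m mu_min)%N &
      ~ cluster_graph e -> ~ complete_multipartite e ->
      is_dimE R e (minn (n - 1 - m mu_max) (n - 1 - m mu_min))%N].
Proof.
move=> m; rewrite subn1.
have rep_max := representable_mu_max G_simple V_basis mu_maxP.
have rep_min := representable_mu_min G_simple V_basis mu_minP.
have lower := representable_lower_bound G_simple V_basis mu_minP mu_maxP.
have excl := cluster_multipartite_excl G_simple G_not_complete G_not_null.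
have mu_max_gt0 := not_multipartite_mu_max G_simple V_basis mu_minP mu_maxP.
have mu_min_lt := not_cluster_mu_min G_simple V_basis mu_minP mu_maxP.
split=> [cl|mult|not_cl not_mult].
- split=> [|r /lower[[_ //]|[mu_lt _]|]].
  + by apply/rep_max/mu_max_gt0 => /(excl cl).
  + by have := cluster_mu_min V_basis mu_minP cl; rewrite leNgt mu_lt.
  + exact/leq_trans/leq_subr.
- split=> [|r /lower[[mu_gt _]|[_ //]|]].
  + by apply/rep_min/mu_min_lt => /excl; apply.
  + have := multipartite_mu_max G_simple V_basis mu_maxP mult.
    by rewrite leNgt mu_gt.
  + exact/leq_trans/leq_subr.
- split=> [|r /lower[[_]|[_]|] le_r].
  + rewrite /minn; case: ifP => _; first exact/rep_max/mu_max_gt0.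
    exact/rep_min/mu_min_lt.
  + by rewrite geq_min le_r.
  + by rewrite geq_min le_r orbT.
  + by rewrite geq_min (leq_trans (leq_subr _ _) le_r).
Qed.
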